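(* Let $\mathcal{A} \in \mathbb{C}^{I_1\times\cdots\times I_M \times J_1\times\cdots\times J_N}$ and $\mathcal{B} \in \mathbb{C}^{J_1\times\cdots\times J_N \times K_1\times\cdots\times K_L}$. Let $\mathcal{M} \in \mathbb{C}^{I_1\times\cdots\times I_M \times I_1 \times\cdots\times I_M}$, $\mathcal{N} \in \mathbb{C}^{K_1\times\cdots\times K_L \times K_1 \times\cdots\times K_L}$ and $\mathcal{P} \in \mathbb{C}^{J_1\times\cdots\times J_N \times J_1 \times\cdots\times J_N}$ be Hermitian positive definite tensors. Then $$(\mathcal{A}*_N\mathcal{B})^\dagger_{\mathcal{M},\mathcal{N}} = \mathcal{B}^\dagger_{\mathcal{P},\mathcal{N}}*_N \mathcal{A}^\dagger_{\mathcal{M},\mathcal{P}}$$ if and only if $$(\mathcal{A}^\dagger_{\mathcal{M},\mathcal{P}}*_M \mathcal{A}*_N\mathcal{B})^\dagger_{\mathcal{P},\mathcal{N}} = \mathcal{B}^\dagger_{\mathcal{P},\mathcal{N}}*_N\mathcal{A}^\dagger_{\mathcal{M},\mathcal{P}}*_M\mathcal{A}\quad\text{and}\quad (\mathcal{A}*_N\mathcal{B}*_L\mathcal{B}^\dagger_{\mathcal{P},\mathcal{N}})^\dagger_{\mathcal{M},\mathcal{P}} = \mathcal{B}*_L \mathcal{B}^\dagger_{\mathcal{P},\mathcal{N}}*_N\mathcal{A}^\dagger_{\mathcal{M},\mathcal{P}}.$$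
   Context: Einstein product: for $\mathcal{A}\in\mathbb{C}^{I_1\times\cdots\times I_M\times J_1\times\cdots\times J_N}$ and $\mathcal{B}\in\mathbb{C}^{J_1\times\cdots\times J_N\times K_1\times\cdots\times K_L}$, $(\mathcal{A}*_N\mathcal{B})_{i_1\ldots i_Mk_1\ldots k_L}=\sum_{j_1,\ldots,j_N}a_{i_1\ldots i_Mj_1\ldots j_N}b_{j_1\ldots j_Nk_1\ldots k_L}$ (the subscript is the number of contracted indices; similarly $*_M,*_L$). The conjugate transpose $\mathcal{A}^*$ has entries $(\mathcal{A}^* )_{j_1\ldots j_Ni_1\ldots i_M}=\overline{a_{i_1\ldots i_Mj_1\ldots j_N}}$. Identity tensors have entries equal to products of Kronecker deltas. A tensor $\mathcal{Q}$ with the same row and column index sets is Hermitian positive definite if $\mathcal{Q}=\mathcal{Z}*\mathcal{D}*\mathcal{Z}^*$ (Einstein products over all the row indices) with $\mathcal{Z}$ unitary ($\mathcal{Z}*\mathcal{Z}^*=\mathcal{Z}^**\mathcal{Z}$ is the identity tensor) and $\mathcal{D}$ a diagonal tensor with positive diagonal entries. Weighted Moore-Penrose inverse: for $\mathcal{A}\in\mathbb{C}^{I_1\times\cdots\times I_M\times J_1\times\cdots\times J_N}$ and Hermitian positive definite $\mathcal{M}$ (on $I_1\times\cdots\times I_M$) and $\mathcal{P}$ (on $J_1\times\cdots\times J_N$), $\mathcal{A}^\dagger_{\mathcal{M},\mathcal{P}}$ is the unique $\mathcal{Y}\in\mathbb{C}^{J_1\times\cdots\times J_N\times I_1\times\cdots\times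 I_M}$ with $\mathcal{A}*_N\mathcal{Y}*_M\mathcal{A}=\mathcal{A}$, $\mathcal{Y}*_M\mathcal{A}*_N\mathcal{Y}=\mathcal{Y}$, $(\mathcal{M}*_M\mathcal{A}*_N\mathcal{Y})^*=\mathcal{M}*_M\mathcal{A}*_N\mathcal{Y}$, $(\mathcal{P}*_N\mathcal{Y}*_M\mathcal{A})^*=\mathcal{P}*_N\mathcal{Y}*_M\mathcal{A}$; similarly for other index sets. *)

(* Defs.v *)
From HB Require Import structures.
From mathcomp Require Import all_boot all_order all_algebra.
From mathcomp Require Import complex.
From mathcomp Require Import boolp classical_sets reals.
Set Implicit Arguments.
Unset Strict Implicit.
Unset Printing Implicit Defensive.
Import Order.TTheory GRing.Theory Num.Theory.
Local Open Scope ring_scope.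
Local Open Scope complex_scope.

(* Multi-indices (i_1, ..., i_m) with i_k ranging over 'I_(I k). *)
Definition mindex (m : nat) (I : 'I_m -> nat) : finType :=
  {dffun forall k : 'I_m, 'I_(I k)}.

(* Complex tensors of size I_1 x ... x I_m x J_1 x ... x J_n; the two groups of
   modes are kept apart, so that the number of contracted modes in an Einstein
   product is determined by the types. *)
Definition tensor (R : realType) (m n : nat)
    (I : 'I_m -> nat) (J : 'I_n -> nat) :=
  {ffun mindex I * mindex J -> R[i]}.

Definition einstein (R : realType) (m n l : nat)
    (I : 'I_m -> nat) (J : 'I_n -> nat) (K : 'I_l -> nat)
    (A : tensor R I J) (B : tensor R J K) : tensor R I K :=
  [ffun ik => \sum_(j : mindex J) A (ik.1, j) * B (j, ik.2)].

Declare Scope tensor_scope.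
Delimit Scope tensor_scope with T.
Notation "A *t B" := (einstein A B)
  (at level 40, left associativity) : tensor_scope.
Local Open Scope tensor_scope.

Definition ctrans (R : realType) (m n : nat)
    (I : 'I_m -> nat) (J : 'I_n -> nat) (A : tensor R I J) : tensor R J I :=
  [ffun ji => (A (ji.2, ji.1))^*].

Definition idtensor (R : realType) (m : nat) (I : 'I_m -> nat) :
    tensor R I I :=
  [ffun ij : mindex I * mindex I =>
     \prod_(k < m) ((ij.1 : mindex I) k == (ij.2 : mindex I) k)%:R].

Definition unitary (R : realType) (m : nat) (I : 'I_m -> nat)
    (Z : tensor R I I) : Prop :=
  Z *t ctrans Z = idtensor R I /\ ctrans Z *t Z = idtensor R I.

Definition diagonal (R : realType) (m : nat) (I : 'I_m -> nat)
    (D : tensor R I I) : Prop :=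
  forall i j : mindex I, i <> j -> D (i, j) = 0.

(* In R[i], 0 < z means that z is real and positive. *)
Definition hermitian_posdef (R : realType) (m : nat) (I : 'I_m -> nat)
    (Q : tensor R I I) : Prop :=
  exists Z D : tensor R I I,
    [/\ unitary Z, diagonal D, forall i : mindex I, 0 < D (i, i)
      & Q = Z *t D *t ctrans Z].

Definition is_wmpinv (R : realType) (m n : nat)
    (I : 'I_m -> nat) (J : 'I_n -> nat)
    (M : tensor R I I) (P : tensor R J J)
    (A : tensor R I J) (Y : tensor R J I) : Prop :=
  [/\ A *t Y *t A = A,
      Y *t A *t Y = Y,
      ctrans (M *t A *t Y) = M *t A *t Y
    & ctrans (P *t Y *t A) = P *t Y *t A].

(* The weighted Moore-Penrose inverse of A. For Hermitian positive definite M
   and P exactly one Y satisfies is_wmpinv M P A Y; the default value 0 is used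
   only when no such Y exists. *)
Definition wmpinv (R : realType) (m n : nat)
    (I : 'I_m -> nat) (J : 'I_n -> nat)
    (M : tensor R I I) (P : tensor R J J) (A : tensor R I J) : tensor R J I :=
  xget (0 : {ffun mindex J * mindex I -> R[i]})
    [set Y : tensor R J I | is_wmpinv M P A Y]%classic.

(* Main.v *)
(* Write X and Y for the inverses of A and B and put E = XA, F = BY; both are
   projections whose products with P on the left are Hermitian.  The first two
   defining equations for "YX is the inverse of AB" read AFEB = AB and
   YEFX = YX; multiplied by X or A, Y or B on the appropriate side, they become
   the corresponding equations for EB and AF, and AE = A, EX = X, FB = B, YF = Y
   undo these multiplications.  Of the remaining equations, P(EFE) and P(FEF)
   Hermitian hold automatically and the others are shared by the two sides.
   To turn "is a weighted inverse" into an equation with wmpinv one needs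
   existence and uniqueness.  Existence is obtained on matrices from a
   full-rank factorization A = CH, with
   X = P^-1 H* (H P^-1 H* )^-1 (C* M C)^-1 C* M. *)
Require Import Defs.
From mathcomp Require Import all_boot all_order all_algebra.
From mathcomp Require Import complex classical_sets reals.
Set Implicit Arguments.
Unset Strict Implicit.
Unset Printing Implicit Defensive.
Import Order.TTheory GRing.Theory Num.Theory.
Local Open Scope ring_scope.
Local Open Scope sesquilinear_scope.
Local Open Scope tensor_scope.

Lemma trmxC_mul (C : numClosedFieldType) m n p
    (A : 'M[C]_(m, n)) (B : 'M[C]_(n, p)) :
  (A *m B)^t* = B^t* *m A^t*.
Proof. by rewrite trmx_mul map_mxM. Qed.

(** The form in which positive definiteness is used on matrices: it makes Gram matrices of
    independent rows invertible and passes to inverses. *)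
Definition anisotropic_hermitian (C : numClosedFieldType) n (Q : 'M[C]_n) :=
  Q^t* = Q /\ forall v : 'rV_n, v *m Q *m v^t* = 0 -> v = 0.

Definition is_wmpinv_mx (C : numClosedFieldType) m n
    (M : 'M[C]_m) (P : 'M[C]_n) (A : 'M[C]_(m, n)) (Y : 'M[C]_(n, m)) :=
  [/\ A *m Y *m A = A,
      Y *m A *m Y = Y,
      (M *m A *m Y)^t* = M *m A *m Y
    & (P *m Y *m A)^t* = P *m Y *m A].

(** If [v] kills the Gram matrix, then [v *m W] is isotropic for [Q], hence zero, and independence
    of the rows of [W] gives [v = 0]. *)
Lemma gram_unitmx (C : numClosedFieldType) m n
    (Q : 'M[C]_n) (W : 'M[C]_(m, n)) :
  anisotropic_hermitian Q -> row_free W -> W *m Q *m W^t* \in unitmx.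
Proof.
move=> [_ Q0] Wfree; rewrite -row_free_unit; apply: inj_row_free => v vG.
apply: (row_free_inj Wfree); rewrite mul0mx; apply: Q0.
by rewrite trmxC_mul !mulmxA in vG *; rewrite vG mul0mx.
Qed.

Lemma anisotropic_unitmx (C : numClosedFieldType) n (Q : 'M[C]_n) :
  anisotropic_hermitian Q -> Q \in unitmx.
Proof.
move=> [_ Q0]; rewrite -row_free_unit; apply: inj_row_free => v vQ.
by apply: Q0; rewrite vQ mul0mx.
Qed.

Lemma invmx_hermitian (C : numClosedFieldType) n (Q : 'M[C]_n) :
  Q^t* = Q -> (invmx Q)^t* = invmx Q.
Proof. by move=> QH; rewrite trmx_inv map_invmx QH. Qed.

Lemma anisotropic_invmx (C : numClosedFieldType) n (Q : 'M[C]_n) :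
  anisotropic_hermitian Q -> anisotropic_hermitian (invmx Q).
Proof.
move=> hQ; have uQ := anisotropic_unitmx hQ; case: hQ => QH Q0.
have QiH := invmx_hermitian QH.
split=> // v vQv; apply: (row_free_inj (A := invmx Q)).
  by rewrite row_free_unit unitmx_inv.
rewrite mul0mx; apply: Q0.
by rewrite trmxC_mul QiH mulmxKV // mulmxA.
Qed.

Lemma wmpinv_mx_exists (C : numClosedFieldType) m n
    (M : 'M[C]_m) (P : 'M[C]_n) (A : 'M[C]_(m, n)) :
  anisotropic_hermitian M -> anisotropic_hermitian P ->
  exists Y, is_wmpinv_mx M P A Y.
Proof.
move=> hM hP; have hPi := anisotropic_invmx hP.
have uP := anisotropic_unitmx hP.
have defA := mulmx_base A; have Hfree := row_base_free A.
have Ffull := col_base_full A.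
(* Only [A = F H] and the full ranks of the factors are kept; [F] is the factor called C in the
   overview. *)
move: (\rank A) (col_base A) (row_base A) defA Hfree Ffull.
move=> r F H defA Hfree Ffull.
have uG := gram_unitmx hPi Hfree.
have uK : F^t* *m M *m F \in unitmx.
  (* This is the Gram matrix of [F^t*], whose rows are independent because [F] has full column
     rank. *)
  rewrite -{2}[F]trmxCK; apply: gram_unitmx => //.
  by rewrite -row_leq_rank mxrank_map mxrank_tr col_leq_rank.
move: hM hP hPi => [MH _] [PH _] [PiH _].
have GiH : (invmx (H *m invmx P *m H^t*))^t* = invmx (H *m invmx P *m H^t*).
  by apply: invmx_hermitian; rewrite !trmxC_mul trmxCK PiH !mulmxA.
have KiH : (invmx (F^t* *m M *m F))^t* = invmx (F^t* *m M *m F).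
  by apply: invmx_hermitian; rewrite !trmxC_mul trmxCK MH !mulmxA.
set Gi := invmx (H *m _ *m _) in GiH *; set Ki := invmx (_ *m F) in KiH *.
pose Y := invmx P *m H^t* *m Gi *m Ki *m F^t* *m M.
have AY : A *m Y = F *m Ki *m F^t* *m M.
  have -> : A *m Y = F *m (H *m invmx P *m H^t* *m Gi) *m Ki *m F^t* *m M.
    by rewrite -defA /Y !mulmxA.
  by rewrite mulmxV // mulmx1.
have YA : Y *m A = invmx P *m H^t* *m Gi *m H.
  have -> : Y *m A = invmx P *m H^t* *m Gi *m (Ki *m (F^t* *m M *m F)) *m H.
    by rewrite -defA /Y !mulmxA.
  by rewrite mulVmx // mulmx1.
have AYF : A *m Y *m F = F.
  by rewrite AY -!mulmxA (mulmxA _ M) mulVmx // mulmx1.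
exists Y; split.
- by rewrite -{2}defA mulmxA AYF defA.
- have -> : Y *m A *m Y
    = invmx P *m H^t* *m Gi *m (H *m invmx P *m H^t* *m Gi) *m Ki *m F^t* *m M.
    by rewrite YA /Y !mulmxA.
  by rewrite mulmxV // mulmx1.
- by rewrite -(mulmxA M) AY !trmxC_mul trmxCK MH KiH !mulmxA.
- rewrite -(mulmxA P) YA !mulmxA mulmxV // mul1mx ?trmxC_mul.
  by rewrite trmxCK GiH mulmxA.
Qed.

(** [A Y1] and [A Y2] are idempotents with the same range, self-adjoint for the form [M], hence
    equal. Likewise [Y1 A] and [Y2 A] share their kernel and are self-adjoint for [P]. Then Y1 = Y1
    A Y1 = Y1 A Y2 = Y2 A Y2 = Y2. *)
Lemma wmpinv_mx_uniq (C : numClosedFieldType) m n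
    (M : 'M[C]_m) (P : 'M[C]_n) (A : 'M[C]_(m, n)) Y1 Y2 :
  anisotropic_hermitian M -> anisotropic_hermitian P ->
  is_wmpinv_mx M P A Y1 -> is_wmpinv_mx M P A Y2 -> Y1 = Y2.
Proof.
move=> hM hP [AYA1 YAY1 MH1 PH1] [AYA2 YAY2 MH2 PH2].
have uM := anisotropic_unitmx hM; have uP := anisotropic_unitmx hP.
move: hM hP => [MH _] [PH _].
rewrite -mulmxA trmxC_mul MH in MH1; rewrite -mulmxA trmxC_mul MH in MH2.
rewrite -mulmxA trmxC_mul PH in PH1; rewrite -mulmxA trmxC_mul PH in PH2.
have eqAY : A *m Y1 = A *m Y2.
  apply: (can_inj (mulKmx uM)).
  have -> : M *m (A *m Y1) = M *m (A *m Y2) *m (A *m Y1).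
    by rewrite -!mulmxA (mulmxA A) (mulmxA (A *m Y2)) AYA2.
  by rewrite -MH2 -mulmxA -MH1 mulmxA -trmxC_mul !mulmxA AYA1.
have eqYA : Y1 *m A = Y2 *m A.
  apply: (can_inj (mulKmx uP)).
  have -> : P *m (Y1 *m A) = P *m (Y1 *m A) *m (Y2 *m A).
    by rewrite -!mulmxA (mulmxA A) AYA2.
  by rewrite -PH1 -mulmxA -PH2 mulmxA -trmxC_mul -mulmxA (mulmxA A) AYA1.
by rewrite -YAY1 -mulmxA eqAY mulmxA eqYA YAY2.
Qed.

(** [E] and [F] are self-adjoint for the form [P], and the word E F E is its own reversal. *)
Lemma hermitian_sandwich (C : numClosedFieldType) n (P E F : 'M[C]_n) :
  P^t* = P -> E^t* *m P = P *m E -> F^t* *m P = P *m F ->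
  (P *m (E *m F *m E))^t* = P *m (E *m F *m E).
Proof.
move=> PH PE PF; rewrite !trmxC_mul PH -!mulmxA PE (mulmxA (F^t*)) PF.
by rewrite !mulmxA PE.
Qed.

Lemma reverse_order_law_mx (C : numClosedFieldType) m n l
    (M : 'M[C]_m) (N : 'M[C]_l) (P : 'M[C]_n)
    (A : 'M[C]_(m, n)) (B : 'M[C]_(n, l)) X Y :
  P^t* = P -> is_wmpinv_mx M P A X -> is_wmpinv_mx P N B Y ->
  is_wmpinv_mx M N (A *m B) (Y *m X) <->
  is_wmpinv_mx P N (X *m A *m B) (Y *m X *m A) /\
  is_wmpinv_mx M P (A *m B *m Y) (B *m Y *m X).
Proof.
move=> PH [AXA XAX _ EH] [BYB YBY FH _].
rewrite -mulmxA in EH; rewrite -mulmxA in FH.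
set E := X *m A in EH; set F := B *m Y in FH.
have PE : E^t* *m P = P *m E by rewrite -EH trmxC_mul PH.
have PF : F^t* *m P = P *m F by rewrite -FH trmxC_mul PH.
have EE : E *m E = E by rewrite /E mulmxA XAX.
have FF : F *m F = F by rewrite /F mulmxA BYB.
have PEFE := hermitian_sandwich PH PE PF.
have PFEF := hermitian_sandwich PH PF PE.
have H4E : N *m (Y *m X *m A) *m (X *m A *m B) = N *m (Y *m X) *m (A *m B).
  have -> : N *m (Y *m X *m A) *m (X *m A *m B) = N *m Y *m (E *m E) *m B.
    by rewrite /E !mulmxA.
  by rewrite EE /E !mulmxA.
have H3E : M *m (A *m B *m Y) *m (B *m Y *m X) = M *m (A *m B) *m (Y *m X).
  have -> : M *m (A *m B *m Y) *m (B *m Y *m X) = M *m A *m (F *m F) *m X.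
    by rewrite /F !mulmxA.
  by rewrite FF /F !mulmxA.
rewrite /is_wmpinv_mx H4E H3E.
have -> : P *m (X *m A *m B) *m (Y *m X *m A) = P *m (E *m F *m E).
  by rewrite /E /F !mulmxA.
have -> : P *m (B *m Y *m X) *m (A *m B *m Y) = P *m (F *m E *m F).
  by rewrite /E /F !mulmxA.
have -> : A *m B *m (Y *m X) *m (A *m B) = A *m F *m E *m B.
  by rewrite /E /F !mulmxA.
have -> : Y *m X *m (A *m B) *m (Y *m X) = Y *m E *m F *m X.
  by rewrite /E /F !mulmxA.
(* In these four products the brackets isolate, once [EE] and [FF] are applied, the words A F E B
   and Y E F X from the equations for [A *m B]. *)
have -> : X *m A *m B *m (Y *m X *m A) *m (X *m A *m B)
    = X *m (A *m F *m (E *m E) *m B) by rewrite /E /F !mulmxA.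
have -> : Y *m X *m A *m (X *m A *m B) *m (Y *m X *m A)
    = Y *m (E *m E) *m F *m X *m A by rewrite /E /F !mulmxA.
have -> : A *m B *m Y *m (B *m Y *m X) *m (A *m B *m Y)
    = A *m (F *m F) *m E *m B *m Y by rewrite /E /F !mulmxA.
have -> : B *m Y *m X *m (A *m B *m Y) *m (B *m Y *m X)
    = B *m (Y *m E *m (F *m F) *m X) by rewrite /E /F !mulmxA.
rewrite EE FF.
(* The converse takes equations 1, 2 and 4 from the first inverse and 3 from the second. In 1, [X]
   is cancelled by [A] on the left; in 2, [A] is cancelled by [X] on the right. *)
split=> [[H1 H2 H3 H4] | [[H1 H2 _ H4] [_ _ H3 _]]].
  by rewrite H1 H2; split; split=> //; rewrite ?mulmxA.
split=> //.
- have -> : A *m F *m E *m B = A *m (X *m (A *m F *m E *m B)).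
    by rewrite !(mulmxA A) !mulmxA AXA.
  by rewrite H1 !mulmxA AXA.
- have -> : Y *m E *m F *m X = Y *m E *m F *m X *m A *m X.
    by rewrite -{1}XAX !mulmxA.
  by rewrite H2 -!mulmxA (mulmxA X) XAX.
Qed.

(** Numbering the multi-indices makes this unfolding a bijection that carries Einstein products to
    matrix products. *)
Definition tensor_mx (R : realType) m n (I : 'I_m -> nat) (J : 'I_n -> nat)
    (A : tensor R I J) : 'M[R[i]]_(#|mindex I|, #|mindex J|) :=
  \matrix_(i, j) A (enum_val i, enum_val j).

Lemma tensor_mx_inj (R : realType) m n (I : 'I_m -> nat) (J : 'I_n -> nat) :
  injective (@tensor_mx R m n I J).
Proof.
move=> A B /matrixP eqAB; apply/ffunP => -[i j].
by have := eqAB (enum_rank i) (enum_rank j); rewrite !mxE !enum_rankK.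
Qed.

Lemma tensor_mx_surj (R : realType) m n (I : 'I_m -> nat) (J : 'I_n -> nat)
    (A : 'M[R[i]]_(#|mindex I|, #|mindex J|)) :
  exists A' : tensor R I J, tensor_mx A' = A.
Proof.
exists [ffun ij => A (enum_rank ij.1) (enum_rank ij.2)].
by apply/matrixP => i j; rewrite !mxE ffunE !enum_valK.
Qed.

Lemma tensor_mxM (R : realType) m n l
    (I : 'I_m -> nat) (J : 'I_n -> nat) (K : 'I_l -> nat)
    (A : tensor R I J) (B : tensor R J K) :
  tensor_mx (A *t B) = tensor_mx A *m tensor_mx B.
Proof.
apply/matrixP => i k; rewrite !mxE ffunE /=.
rewrite (reindex _ (onW_bij _ (enum_val_bij (mindex J)))) /=.
by apply: eq_bigr => j _; rewrite !mxE.
Qed.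

Lemma tensor_mx_ctrans (R : realType) m n (I : 'I_m -> nat) (J : 'I_n -> nat)
    (A : tensor R I J) :
  tensor_mx (ctrans A) = (tensor_mx A)^t*.
Proof. by apply/matrixP => i j; rewrite !mxE ffunE. Qed.

Lemma tensor_mx_id (R : realType) m (I : 'I_m -> nat) :
  tensor_mx (idtensor R I) = 1%:M.
Proof.
apply/matrixP => i j; rewrite !mxE ffunE /= -(inj_eq enum_val_inj).
have [-> | neq_ij] := eqVneq (enum_val i) (enum_val j).
  by rewrite big1 // => k _; rewrite eqxx.
(* Distinct multi-indices differ in some mode, whose Kronecker delta annihilates the product. *)
have [k neq_k] : exists k, enum_val i k != enum_val j k.
  apply/existsP; apply: contraNT neq_ij; rewrite negb_exists => /forallP eq_ij.
  by apply/eqP/ffunP => k; apply/eqP; rewrite -[_ == _]negbK eq_ij.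
by rewrite (bigD1 k) //= (negPf neq_k) mul0r.
Qed.

(** In the coordinates w = v U, with U the unfolded unitary factor, the form is the sum of d_i
    |w_i|^2 with all d_i positive; it vanishes only at w = 0, and U is invertible. *)
Lemma posdef_anisotropic (R : realType) m (I : 'I_m -> nat)
    (Q : tensor R I I) :
  hermitian_posdef Q -> anisotropic_hermitian (tensor_mx Q).
Proof.
case=> Z [D [[ZZ _] Ddiag Dpos ->]]; rewrite !tensor_mxM tensor_mx_ctrans.
have {}ZZ : tensor_mx Z *m (tensor_mx Z)^t* = 1%:M.
  by rewrite -tensor_mx_ctrans -tensor_mxM ZZ tensor_mx_id.
pose d : 'rV_#|mindex I| := \row_i D (enum_val i, enum_val i).
have -> : tensor_mx D = diag_mx d.
  apply/matrixP => i j; rewrite !mxE.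
  have [-> | neq_ij] := eqVneq i j; first by rewrite mulr1n.
  by rewrite mulr0n Ddiag // => /enum_val_inj/eqP; apply/negP.
have d_gt0 i : 0 < d 0 i by rewrite mxE.
move: (tensor_mx Z) d d_gt0 ZZ => U d d_gt0 UU {Z D Ddiag Dpos}.
split.
  rewrite !trmxC_mul trmxCK mulmxA; congr (_ *m _ *m _).
  apply/matrixP => i j; rewrite !mxE.
  have [-> | _] := eqVneq j i; last by rewrite !mulr0n conjC0.
  by rewrite !mulr1n; apply/CrealP/gtr0_real.
move=> v vQ; have Ufree : row_free U by apply/row_freeP; exists (U^t*).
apply: (row_free_inj Ufree); rewrite mul0mx; set w := v *m U.
have {}vQ : w *m diag_mx d *m w^t* = 0.
  by rewrite /w trmxC_mul -vQ !mulmxA.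
have sum0 : \sum_i d 0 i * `|w 0 i| ^+ 2 = 0.
  move/matrixP: vQ => /(_ 0 0); rewrite mxE [RHS]mxE; apply: etrans.
  apply: eq_bigr => i _; rewrite mul_mx_diag !mxE normCK.
  by rewrite mulrA (mulrC (d 0 i)).
apply/rowP => i; rewrite [RHS]mxE; apply/eqP.
have /psumr_eq0P/(_ sum0 i isT)/eqP :
    forall i, true -> 0 <= d 0 i * `|w 0 i| ^+ 2.
  by move=> k _; rewrite mulr_ge0 ?exprn_ge0 // ltW.
by rewrite mulf_eq0 gt_eqF //= sqrf_eq0 normr_eq0.
Qed.

Lemma is_wmpinv_mxE (R : realType) m n (I : 'I_m -> nat) (J : 'I_n -> nat)
    (M : tensor R I I) (P : tensor R J J) (A : tensor R I J)
    (Y : tensor R J I) :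
  is_wmpinv M P A Y <->
  is_wmpinv_mx (tensor_mx M) (tensor_mx P) (tensor_mx A) (tensor_mx Y).
Proof.
rewrite /is_wmpinv_mx -!tensor_mxM -!tensor_mx_ctrans.
split=> [[-> -> -> ->] // | [E1 E2 E3 E4]].
by split; apply: tensor_mx_inj.
Qed.

(** Existence rules out the default value in [wmpinv]; uniqueness gives the converse direction. *)
Lemma wmpinv_eqP (R : realType) m n (I : 'I_m -> nat) (J : 'I_n -> nat)
    (M : tensor R I I) (P : tensor R J J) (A : tensor R I J)
    (Y : tensor R J I) :
  hermitian_posdef M -> hermitian_posdef P ->
  wmpinv M P A = Y <-> is_wmpinv M P A Y.
Proof.
move=> /posdef_anisotropic hM /posdef_anisotropic hP.
have : is_wmpinv M P A (wmpinv M P A).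
  have [Y' hY'] := wmpinv_mx_exists (tensor_mx A) hM hP.
  have [Y'' defY'] := tensor_mx_surj Y'.
  by apply: xgetPex; exists Y''; apply/is_wmpinv_mxE; rewrite defY'.
move=> inv; split=> [<- // | /is_wmpinv_mxE hY].
by apply: tensor_mx_inj; apply: wmpinv_mx_uniq hM hP _ hY; apply/is_wmpinv_mxE.
Qed.

Theorem theorem14 (R : realType) (m n l : nat)
    (I : 'I_m -> nat) (J : 'I_n -> nat) (K : 'I_l -> nat)
    (A : tensor R I J) (B : tensor R J K)
    (M : tensor R I I) (N : tensor R K K) (P : tensor R J J)
    (hM : hermitian_posdef M) (hN : hermitian_posdef N)
    (hP : hermitian_posdef P) :
  wmpinv M N (A *t B) = wmpinv P N B *t wmpinv M P A
  <->
  wmpinv P N (wmpinv M P A *t A *t B) = wmpinv P N B *t wmpinv M P A *t A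
  /\
  wmpinv M P (A *t B *t wmpinv P N B) = B *t wmpinv P N B *t wmpinv M P A.
Proof.
have /is_wmpinv_mxE invA : is_wmpinv M P A (wmpinv M P A) by apply/wmpinv_eqP.
have /is_wmpinv_mxE invB : is_wmpinv P N B (wmpinv P N B) by apply/wmpinv_eqP.
(* Only the outer inverses are unfolded; those of [A] and [B] remain as the [X] and [Y] of the
   matrix law. *)
rewrite !wmpinv_eqP // !is_wmpinv_mxE !tensor_mxM.
by apply: reverse_order_law_mx => //; case: (posdef_anisotropic hP).
Qed.
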